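(* Let $d$ be sufficiently large and let $B(2d-1,d)$ be the bipartite graph with vertex set $\{x\subseteq[2d-1]:|x|\in\{d-1,d\}\}$ in which $x,y$ are adjacent iff $x\subsetneq y$. Let $\mathcal{J}_2$ be the set of maximal independent sets $I$ of $B(2d-1,d)$ with $|M(I)|>\left(1-\frac{2\log^5 d}{d^{3/2}}\right)\binom{2d-2}{d-1}$. For $k\in[2d-1]$ let $M_k=\{uv: k\in u,\ |u|=d,\ v=u\setminus\{k\}\}$. Then for every $I\in\mathcal{J}_2$ there exists $k\in[2d-1]$ such that \[ |M(I)\cap M_k|\geq\left(1-\frac{25\log^5 d}{\sqrt d}\right)\binom{2d-2}{d-1}. \]
   Context: $\log$ denotes $\log_2$. An induced matching in a graph is a set $M$ of pairwise disjoint edges such that for distinct $xy,uv\in M$ none of $xu,xv,yu,yv$ is an edge. For an independent set $I$ of $B(2d-1,d)$, $M(I)$ is a fixed induced matching of maximum size among those induced matchings $M$ such that every edge $xy\in M$ satisfies $|\{x,y\}\cap I|=1$ and every $v\in I\setminus V(M)$ has no neighbor in $V(M)$ (ties broken by a fixed ordering; the empty matching is allowed). *)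

(* Defs.v *)
From HB Require Import structures.
From mathcomp Require Import all_boot all_order all_algebra.
From mathcomp Require Import reals exp.

Set Implicit Arguments.
Unset Strict Implicit.
Unset Printing Implicit Defensive.

Import Order.TTheory GRing.Theory Num.Theory.

(* A graph on a finite type T is given by its adjacency relation [e : rel T]
   (symmetric and irreflexive in the intended use); an edge is the two-element
   set of its endpoints. *)
Definition edges (T : finType) (e : rel T) : {set {set T}} :=
  [set E : {set T} | [exists x, exists y, e x y && (E == [set x; y])]].

Definition independent (T : finType) (e : rel T) (I : {set T}) : bool :=
  [forall x in I, forall y in I, ~~ e x y].

Definition maximal_independent (T : finType) (e : rel T) (I : {set T}) : bool :=
  maxset (independent e) I.

Definition induced_matching (T : finType) (e : rel T) (M : {set {set T}}) :
    bool :=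
  [&& M \subset edges e,
      [forall E in M, forall F in M, (E != F) ==> [disjoint E & F]] &
      [forall E in M, forall F in M, (E != F) ==>
         [forall x in E, forall y in F, ~~ e x y]]].

(* V(M) is [cover M]. *)
Definition admissible (T : finType) (e : rel T) (I : {set T})
    (M : {set {set T}}) : bool :=
  [&& induced_matching e M,
      [forall E in M, #|E :&: I| == 1%N] &
      [forall v in I :\: cover M, forall w in cover M, ~~ e v w]].

Definition max_admissible (T : finType) (e : rel T) (I : {set T})
    (M : {set {set T}}) : bool :=
  admissible e I M && [forall N, admissible e I N ==> (#|N| <= #|M|)%N].

Definition total_order (A : Type) (le : rel A) : Prop :=
  [/\ reflexive le, antisymmetric le, transitive le & total le].

(* M(I): the le-least admissible matching of maximum size.  The default set0 is
   never reached when [le] is a total order, since the empty matching is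
   admissible. *)
Definition MI (T : finType) (e : rel T) (le : rel {set {set T}})
    (I : {set T}) : {set {set T}} :=
  odflt set0 [pick M | max_admissible e I M &&
                       [forall N, max_admissible e I N ==> le M N]].

(* The ground set [2d-1] is 'I_(2d-1), i.e. shifted to {0, ..., 2d-2}. *)
Definition Bvert (d : nat) : finType :=
  {x : {set 'I_(2 * d - 1)} | (#|x| == d - 1)%N || (#|x| == d)}.

Definition Badj (d : nat) : rel (Bvert d) :=
  fun x y => (val x \proper val y) || (val y \proper val x).

Definition Mdir (d : nat) (k : 'I_(2 * d - 1)) : {set {set Bvert d}} :=
  [set E : {set Bvert d} | [exists u : Bvert d, exists v : Bvert d,
     [&& k \in val u, #|val u| == d, val v == val u :\ k & E == [set u; v]]]].

Local Open Scope ring_scope.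

Definition log2 (R : realType) (x : R) : R := ln x / ln 2.

Definition J2 (R : realType) (d : nat) (le : rel {set {set Bvert d}}) :
    {set {set Bvert d}} :=
  [set I : {set Bvert d} | maximal_independent (@Badj d) I &&
     ((1 - 2 * log2 (d%:R : R) ^+ 5 / (d%:R : R) `^ (3 / 2))
        * ('C(2 * d - 2, d - 1))%:R < #|MI (@Badj d) le I|%:R)].

(* Main.v *)
(* Split the vertices into the two sides of a cut: matched lower vertices and
   unmatched upper ones against the rest.  The cut consists of the matching M and
   the edges with both ends unmatched ("untouched").  As the graph is d-regular,
   counting edges shows that |M| close to N = C(2d-2, d-1) leaves few untouched
   edges.  A cut meets each hexagon in an even number of edges, and inducedness
   allows two matching edges in a hexagon only when they are opposite, hence of
   the same direction.  So a hexagon with exactly one matching edge (a "bad" one)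
   contains an untouched edge at distance one from it, and each untouched edge
   serves at most 2(d-1) bad hexagons.  Thus the set of matching edges of a given
   direction has small edge boundary in the Johnson graph J(2d-2, d-1), whose
   Poincare inequality, summed over the directions, forces one direction to carry
   almost all of M. *)
Require Import Defs.
From HB Require Import structures.
From mathcomp Require Import all_boot all_order all_fingroup all_algebra.
From mathcomp Require Import reals exp.
From mathcomp Require Import zify ring lra.

Set Implicit Arguments.
Unset Strict Implicit.
Unset Printing Implicit Defensive.

(** * Double counting and the Poincare inequality of the Johnson graph J(2m, m) *)

Lemma card_dep_pair (S T : finType) (P : pred S) (Q : S -> pred T) :
  #|[set p : S * T | P p.1 && Q p.1 p.2]| = \sum_(x | P x) #|[set y | Q x y]|.
Proof.
rewrite -sum1dep_card -(pair_big_dep P Q (fun _ _ => 1)) /=.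
by apply: eq_bigr => x _; rewrite sum1dep_card.
Qed.

Definition swap (T : finType) (x : {set T}) (a c : T) := c |: x :\ a.

Section Slice.
Variables (T : finType) (m : nat) (b : T).
Hypothesis cardT : #|T| = m.*2.+1.

(** These are the vertices of J(2m, m) on the ground set without [b]. They are also the lower ends
    of the edges of direction [b], so each direction carries its own Johnson graph. *)
Definition slice := [set x : {set T} | (b \notin x) && (#|x| == m)].

(** These are the directed edges of the Johnson graph: [(x, (a, c))] goes from [x] to
    [swap x a c]. *)
Definition swaps := [set q : {set T} * (T * T) |
  (q.1 \in slice) && ((q.2.1 \in q.1) && (q.2.2 \notin b |: q.1))].

Lemma card_slice : #|slice| = 'C(m.*2, m).
Proof.
have -> : m.*2 = #|[set~ b]| by rewrite cardsC1 cardT.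
rewrite -cards_draws; apply: eq_card => x; rewrite !inE.
by rewrite subsetC sub1set inE.
Qed.

Lemma card_swaps : #|swaps| = 'C(m.*2, m) * (m * m).
Proof.
rewrite (card_dep_pair (mem slice)
  (fun x p => (p.1 \in x) && (p.2 \notin b |: x))) -card_slice.
rewrite -sum_nat_const; apply: eq_bigr => x; rewrite /= inE => /andP[bx /eqP cx].
rewrite (card_dep_pair (mem x) (fun _ c => c \notin b |: x)) -{1}cx.
rewrite -sum_nat_const; apply: eq_bigr => a _.
have -> : [set c | c \notin b |: x] = ~: (b |: x).
  by apply/setP => c; rewrite !inE.
by rewrite cardsCs setCK cardsU1 bx cx cardT -addnn; lia.
Qed.

Lemma card_swap (x : {set T}) a c : a \in x -> c \notin x -> #|swap x a c| = #|x|.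
Proof.
move=> ax cx; rewrite /swap cardsU1 !inE (negPf cx) andbF /=.
by rewrite [RHS](cardsD1 a) ax.
Qed.

Lemma swap_slice q : q \in swaps -> swap q.1 q.2.1 q.2.2 \in slice.
Proof.
case: q => x [a c]; rewrite !inE /= negb_or => /andP[/andP[bx cx] /and3P[ax cb cnx]].
by rewrite card_swap // cx andbT eq_sym (negPf cb) (negPf bx) andbF.
Qed.

Lemma imset_swap (s : {perm T}) (x : {set T}) a c :
  s @: swap x a c = swap (s @: x) (s a) (s c).
Proof.
apply/setP => y; rewrite /swap -(permKV s y) (mem_imset _ _ perm_inj) !inE.
by rewrite !(inj_eq perm_inj) (mem_imset _ _ perm_inj).
Qed.

Lemma slice_perm (s : {perm T}) (x : {set T}) : s b = b -> (s @: x \in slice) = (x \in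
  slice).
Proof.
move=> sb; rewrite !inE card_imset; last exact: perm_inj.
by rewrite -{1}sb (mem_imset _ _ perm_inj).
Qed.

Definition perm_pair (s : {perm T}) (q : {set T} * (T * T)) :=
  (s @: q.1, (s q.2.1, s q.2.2)).

Lemma perm_pair_inj s : injective (perm_pair s).
Proof.
move=> [x [a c]] [x' [a' c']] [] /(imset_inj perm_inj) -> /perm_inj ->.
by move=> /perm_inj ->.
Qed.

Lemma swaps_perm (s : {perm T}) q : s b = b -> (perm_pair s q \in swaps) = (q \in swaps).
Proof.
move=> sb; rewrite ![_ \in swaps]inE slice_perm // !in_setU1.
by rewrite -{1}sb !(mem_imset _ _ perm_inj) (inj_eq perm_inj).
Qed.

(** The ground set is listed in the order [b], [a], [c], rest of [x], rest of the complement. The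
    block lengths depend only on [m], so matching two such lists position by position gives the
    permutation. *)
Lemma swaps_trans q q' : q \in swaps -> q' \in swaps ->
  exists2 s : {perm T}, s b = b & perm_pair s q = q'.
Proof.
move=> qS q'S.
pose l (r : {set T} * (T * T)) := [:: b, r.2.1, r.2.2 & enum (r.1 :\ r.2.1)
  ++ enum (~: (r.2.2 |: (b |: r.1)))].
have lE r : r \in swaps -> [/\ uniq (l r), forall y, y \in l r, size (l r) = #|T| &
    size (enum (r.1 :\ r.2.1)) = m.-1].
  case: r => x [a c]; rewrite !inE /= => /andP[/andP[bx /eqP cx] /andP[ax cnx]].
  have cxa : #|x :\ a| = m.-1 by rewrite -cx (cardsD1 a x) ax.
  have cnx1 : c \notin b |: x by rewrite !inE.
  have sz : size (l (x, (a, c))) = #|T|.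
    rewrite /l /= size_cat -!cardE cxa cardsCs setCK cardsU1 cnx1 cardsU1 bx cx.
    have : 0 < m by rewrite -cx (cardsD1 a) ax.
    by rewrite !add1n cardT -addnn; lia.
  have mm y : y \in l (x, (a, c)).
    rewrite /l /= !in_cons mem_cat !mem_enum !inE.
    by case: (y == b); case: (y == a); case: (y == c); case: (y \in x).
  have ul : uniq (l (x, (a, c))).
    apply: (leq_size_uniq (enum_uniq T)); first by move=> y _; apply: mm.
    by rewrite sz cardE.
  by split; rewrite -?cardE.
have [ul ml sl el] := lE q qS; have [ul' ml' sl' el'] := lE q' q'S.
pose f x := nth b (l q') (index x (l q)).
have fI : injective f.
  have ix x : index x (l q) < size (l q') by rewrite sl' -sl index_mem ml.
  move=> x y /eqP; rewrite nth_uniq // => /eqP.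
  by apply: (index_inj b); apply: ml.
have [s sE] : exists s : {perm T}, s =1 f.
  by exists (perm fI) => x; rewrite permE.
exists s; first by rewrite sE /f /= eqxx.
move: qS q'S el el' s sE {ul ml sl ul' ml' sl' lE fI}; rewrite {}/f {}/l.
case: q => x [a c]; case: q' => x' [a' c'].
rewrite /perm_pair !inE !negb_or /= => /andP[/andP[bx /eqP cx] /and3P[ax cb cnx]].
move=> /andP[/andP[bx' /eqP cx'] /and3P[ax' cb' cnx']] el el' s sE.
have ba : b == a = false by apply: contraNF bx => /eqP ->.
have bc : b == c = false by apply: contraNF cb => /eqP ->.
have ac : a == c = false by apply: contraNF cnx => /eqP <-.
have sa : s a = a' by rewrite sE /= ba eqxx.
have sc : s c = c' by rewrite sE /= bc ac eqxx.
rewrite sa sc; congr (_, _).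
apply/eqP; rewrite eqEcard card_imset ?cx ?cx' ?leqnn ?andbT; last exact: perm_inj.
apply/subsetP => _ /imsetP[y yx ->].
have [->|ya] := eqVneq y a; first by rewrite sa.
have by_ : b == y = false by apply: contraNF bx => /eqP ->.
have cy : c == y = false by apply: contraNF cnx => /eqP ->.
rewrite sE /= by_ cy eq_sym (negPf ya) /= index_cat mem_enum !inE ya yx /=.
(* The index falls in the first enumerated block, so the image of [y] is read off in the
   corresponding block of [q'], which lies inside [x']. *)
have iy : index y (enum (x :\ a)) < m.-1.
  by rewrite -el index_mem mem_enum !inE ya.
rewrite nth_cat el' iy.
have : nth b (enum (x' :\ a')) (index y (enum (x :\ a))) \in enum (x' :\ a').
  by rewrite mem_nth // el'.
by rewrite mem_enum !inE => /andP[].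
Qed.

Variable F : {set {set T}}.
Hypothesis Fslice : F \subset slice.

Definition boundary :=
  [set q in swaps | (q.1 \in F) && (swap q.1 q.2.1 q.2.2 \notin F)].

Let G := [set s : {perm T} | s b == b].
(** This is a directed cut function of [F], symmetrised over the stabiliser of [b]. It keeps the
    triangle inequality of a cut and gains invariance under the group. *)
Let g (x y : {set T}) : nat :=
  \sum_(s in G) (s @: x \in F) && (s @: y \notin F).

Let g_triangle x y z : g x z <= g x y + g y z.
Proof.
rewrite /g -big_split /=; apply: leq_sum => s _.
by case: (_ \in F); case: (s @: y \in F); case: (_ \in F).
Qed.

Let g_perm (s : {perm T}) (x y : {set T}) : s b = b -> g (s @: x) (s @: y) = g x y.
Proof.
move=> sb; rewrite [RHS](reindex_inj (mulgI s)) /g /=.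
apply: eq_big => [t|t _]; first by rewrite !inE permM sb.
suff H (z : {set T}) : (s * t)%g @: z = t @: (s @: z) by rewrite !H.
by rewrite -imset_comp; apply: eq_imset => i; rewrite /= permM.
Qed.

Let g_swaps q q' : q \in swaps -> q' \in swaps ->
  g q.1 (swap q.1 q.2.1 q.2.2) = g q'.1 (swap q'.1 q'.2.1 q'.2.2).
Proof.
by move=> /swaps_trans H /H[s sb <-]; rewrite /= -imset_swap g_perm.
Qed.

(** Exchanging some [a] in [x :\: y] for some [c] in [y :\: x] brings [x] one step closer to [y]. By
    transitivity every such step costs the same as the reference swap [q]. *)
Let g_dist q x y : q \in swaps -> x \in slice -> y \in slice ->
  g x y <= #|x :\: y| * g q.1 (swap q.1 q.2.1 q.2.2).
Proof.
move=> qS; move Ek: #|x :\: y| => k; elim: k x Ek => [|k IHk] x Ek xs ys.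
  have /eqP xy : x == y.
    move: xs ys; rewrite !inE => /andP[_ /eqP cx] /andP[_ /eqP cy].
    by rewrite eqEcard cx cy leqnn andbT -setD_eq0 -cards_eq0 Ek.
  by rewrite xy /g big1 // => s _; rewrite andbN.
have [a /setDP[ax ay]] : exists a, a \in x :\: y by apply/card_gt0P; rewrite Ek.
have [c /setDP[cy cx]] : exists c, c \in y :\: x.
  apply/card_gt0P; move: xs ys; rewrite !inE => /andP[_ /eqP cx] /andP[_ /eqP cy].
  by move: Ek; rewrite !cardsD setIC cx cy => ->.
have cb : c \notin b |: x.
  rewrite !inE (negPf cx) orbF; apply: contraTneq cy => ->.
  by move: ys; rewrite inE => /andP[].
have xS : (x, (a, c)) \in swaps by rewrite inE xs /= ax.
rewrite mulSn; apply: leq_trans (g_triangle x (swap x a c) y) _.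
apply: leq_add; first by rewrite (g_swaps qS xS).
apply: IHk => //; last exact: (swap_slice xS).
apply/eqP; rewrite -eqSS -Ek (cardsD1 a (x :\: y)) !inE ax ay add1n eqSS.
apply/eqP/eq_card => i; rewrite !inE.
by have [->|] := eqVneq i c; [rewrite cy !andbF | case: (i == a); rewrite ?andbF].
Qed.

(* Summed over all pairs of slice members, g gives |G| |F| (N - |F|); summed over
   swaps it gives |G| |boundary|, and there it is constant since G is transitive
   on swaps.  Telescoping along geodesics (of length at most m) compares the two. *)
Lemma slice_poincare :
  m * (#|F| * ('C(m.*2, m) - #|F|)) <= 'C(m.*2, m) * #|boundary|.
Proof.
have G0 : 0 < #|G| by apply/card_gt0P; exists 1%g; rewrite inE perm1.
have imsI (s : {perm T}) : injective (fun x : {set T} => s @: x).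
  by apply: imset_inj; apply: perm_inj.
have sum_pairs : \sum_(x in slice) \sum_(y in slice) g x y
    = #|G| * (#|F| * ('C(m.*2, m) - #|F|)).
  under eq_bigr => x _ do rewrite exchange_big /=.
  rewrite exchange_big /= -sum_nat_const; apply: eq_bigr => s; rewrite inE => /eqP sb.
  (* Each [s] in [G] permutes the slice, so its contribution does not depend on [s]: it is the
     number of pairs with [x] in [F] and [y] outside. *)
  transitivity (\sum_(x in slice) \sum_(y in slice) (x \in F) * (y \notin F)).
    rewrite [RHS](reindex_inj (imsI s)) /=; apply: eq_big => [x|x _].
      by rewrite slice_perm.
    rewrite [RHS](reindex_inj (imsI s)) /=; apply: eq_big => [y|y _].
      by rewrite slice_perm.
    by rewrite mulnb.
  under eq_bigr => x _ do rewrite -big_distrr /=.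
  rewrite -big_distrl /= -!big_mkcondr !sum1_card; congr (_ * _).
    by apply: eq_card => x; apply/andb_idl/(subsetP Fslice).
  rewrite -card_slice -cardsDS //.
  by apply: eq_card => x; rewrite inE andbC.
have sum_swaps : \sum_(q in swaps) g q.1 (swap q.1 q.2.1 q.2.2) = #|G| * #|boundary|.
  rewrite exchange_big /= -sum_nat_const; apply: eq_bigr => s; rewrite inE => /eqP sb.
  rewrite -sum1_card [RHS](reindex_inj (@perm_pair_inj s)) /=.
  rewrite -big_mkcondr; apply: eq_bigl => q.
  by rewrite [RHS]inE swaps_perm // imset_swap.
(* Without any swap there is no reference value for [g]; the count of swaps then forces [m = 0], and
   the left side vanishes. *)
have [q0 q0S|noq] := pickP (mem swaps); last first.
  have : #|swaps| = 0 by apply: eq_card0.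
  rewrite card_swaps => /eqP; rewrite !muln_eq0 orbb -leqn0 leqNgt bin_gt0.
  by rewrite -addnn leq_addr /= => /eqP ->.
pose g1 := g q0.1 (swap q0.1 q0.2.1 q0.2.2).
have e1 : #|G| * #|boundary| = 'C(m.*2, m) * (m * m) * g1.
  rewrite -sum_swaps -card_swaps -sum_nat_const.
  by apply: eq_bigr => q qS; apply: g_swaps.
have e2 : #|G| * (#|F| * ('C(m.*2, m) - #|F|)) <= 'C(m.*2, m) * 'C(m.*2, m) * (m * g1).
  rewrite -sum_pairs -card_slice -mulnA -!sum_nat_const.
  apply: leq_sum => x xs; apply: leq_sum => y ys.
  apply: leq_trans (g_dist q0S xs ys) _; rewrite leq_mul2r; apply/orP; right.
  apply: leq_trans (subset_leq_card (subsetDl x y)) _.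
  by move: xs; rewrite inE => /andP[_ /eqP ->].
rewrite -(leq_pmul2l G0) [leqRHS]mulnCA e1 [leqLHS]mulnCA.
apply: leq_trans (leq_mul (leqnn m) e2) _.
by apply/eq_leq; ring.
Qed.

End Slice.

(** * Untouched edges, bad hexagons and the dominant direction *)

Section DirectedMatching.
(* [mt v b] stands for: the edge from v to b |: v belongs to the matching. *)
Variables (T : finType) (m : nat) (mt : {set T} -> pred T).
Hypothesis cardT : #|T| = m.*2.+1.
Hypothesis mt_edge : forall v b, mt v b -> v \in slice m b.
(** The inclusion says that the lower end of one matching edge is adjacent to the upper end of
    another, so this single condition covers both disjointness and inducedness. *)
Hypothesis mt_induced : forall v b v' b',
  mt v b -> mt v' b' -> v \subset b' |: v' -> v = v' /\ b = b'.

Let N := 'C(m.*2, m).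

Definition matched := [set p : {set T} * T | mt p.1 p.2].
Definition lower (v : {set T}) := [exists b, mt v b].
Definition upper (u : {set T}) := [exists b in u, mt (u :\ b) b].
Definition all_edges := [set p : {set T} * T | p.1 \in slice m p.2].
Definition untouched :=
  [set p in all_edges | ~~ lower p.1 && ~~ upper (p.2 |: p.1)].

Lemma upperE u : reflect (exists v b, mt v b /\ u = b |: v) (upper u).
Proof.
apply: (iffP existsP) => [[b /andP[bu mb]]|[v [b [mb ->]]]].
  by exists (u :\ b), b; rewrite setD1K.
exists b; rewrite setU11 setU1K //.
by move/mt_edge: mb; rewrite inE => /andP[].
Qed.

Lemma mt_upper v b v' b' : mt v b -> mt v' b' -> b |: v = b' |: v' ->
  v = v' /\ b = b'.
Proof. by move=> h h' e; apply: mt_induced h h' _; rewrite -e subsetUr. Qed.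

Lemma card_all_edges : #|all_edges| = m.*2.+1 * N.
Proof.
have -> : #|all_edges| = #|[set p : T * {set T} | (p.1 \in T) && (p.2 \in slice m p.1)]|.
  have swI : injective (fun p : {set T} * T => (p.2, p.1)).
    by move=> [? ?] [? ?] [-> ->].
  rewrite -(card_imset _ swI); apply: eq_card => [[b v]].
  rewrite -[(b, v)]/((fun p : {set T} * T => (p.2, p.1)) (v, b)).
  by rewrite (mem_imset _ _ swI) !inE.
rewrite (card_dep_pair (mem T) (fun b x => x \in slice m b)).
rewrite -cardT -sum_nat_const; apply: eq_bigr => b _.
by rewrite /N -(card_slice b cardT); apply: eq_card => x; rewrite inE.
Qed.

Lemma card_matched_dir : #|matched| = \sum_b #|[set v | mt v b]|.
Proof.
have -> : #|matched| = #|[set p : T * {set T} | (p.1 \in T) && mt p.2 p.1]|.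
  have swI : injective (fun p : {set T} * T => (p.2, p.1)).
    by move=> [? ?] [? ?] [-> ->].
  rewrite -(card_imset _ swI); apply: eq_card => [[b v]].
  rewrite -[(b, v)]/((fun p : {set T} * T => (p.2, p.1)) (v, b)).
  by rewrite (mem_imset _ _ swI) !inE.
by rewrite (card_dep_pair (mem T) (fun b x => mt x b)).
Qed.

(** Matched lower ends meet [m.+1] edges each, and so do matched upper ends. An edge counted on both
    sides is a matching edge, so at least [2 * m.+1 - 1 = m.*2.+1] touched edges arise per matching
    edge, out of [m.*2.+1 * N] in all. *)
Lemma card_untouched : #|untouched| + m.*2.+1 * #|matched| <= m.*2.+1 * N.
Proof.
pose EA := [set p in all_edges | lower p.1].
pose EB := [set p in all_edges | upper (p.2 |: p.1)].
have cA : #|matched| * m.+1 <= #|EA|.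
  pose D := [set q : ({set T} * T) * T | (q.1 \in matched) && (q.2 \notin q.1.1)].
  have -> : #|matched| * m.+1 = #|D|.
    rewrite (card_dep_pair (mem matched) (fun p c => c \notin p.1)) -sum_nat_const.
    apply: eq_bigr => -[v b] /=; rewrite inE /= => /mt_edge;
      rewrite inE => /andP[_ /eqP cv].
    have -> : [set c | c \notin v] = ~: v by apply/setP => c; rewrite !inE.
    by rewrite cardsCs setCK cv cardT -addnn; lia.
  have fI : {in D &, injective (fun q : ({set T} * T) * T => (q.1.1, q.2))}.
    move=> [[v b] c] [[v' b'] c']; rewrite !inE /= => /andP[h _] /andP[h' _] [e ->].
    by have [] := mt_induced h h'; [rewrite e subsetUr | move=> -> ->].
  rewrite -(card_in_imset fI); apply/subset_leq_card/subsetP => _ /imsetP[[[v b] c] + ->].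
  rewrite !inE /= => /andP[h cv]; rewrite cv /=; apply/andP; split.
    by move/mt_edge: h; rewrite inE => /andP[].
  by apply/existsP; exists b.
have cB : #|matched| * m.+1 <= #|EB|.
  pose D := [set q : ({set T} * T) * T | (q.1 \in matched) && (q.2 \in q.1.2 |: q.1.1)].
  have -> : #|matched| * m.+1 = #|D|.
    rewrite (card_dep_pair (mem matched) (fun p c => c \in p.2 |: p.1)) -sum_nat_const.
    apply: eq_bigr => -[v b] /=; rewrite inE /= => /mt_edge;
      rewrite inE => /andP[bv /eqP cv].
    have -> : [set c | c \in b |: v] = b |: v by apply/setP => c; rewrite !inE.
    by rewrite cardsU1 bv cv.
  have fI : {in D &, injective (fun q : ({set T} * T) * T
    => ((q.1.2 |: q.1.1) :\ q.2, q.2))}.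
    move=> [[v b] c] [[v' b'] c'];
      rewrite ![_ \in D]inE ![_ \in matched]inE /= => /andP[h cv] /andP[h' cv'] [e ec].
    have {}e : b |: v = b' |: v' by rewrite -(setD1K cv) -(setD1K cv') e ec.
    by have [-> ->] := mt_upper h h' e; rewrite ec.
  rewrite -(card_in_imset fI); apply/subset_leq_card/subsetP => _ /imsetP[[[v b] c] + ->].
  rewrite [_ \in D]inE [_ \in EB]inE [_ \in all_edges]inE [_ \in slice _ _]inE.
  rewrite [_ \in matched]inE /= => /andP[h cv].
  rewrite setD1K // setD11 /=.
  apply/andP; split; last by apply/upperE; exists v, b.
  move/mt_edge: h; rewrite inE => /andP[bv /eqP cv'].
  by have := cardsD1 c (b |: v); rewrite cv cardsU1 bv cv' !add1n => -[<-].
have cI : #|EA :&: EB| <= #|matched|.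
  apply/subset_leq_card/subsetP => -[v c]; rewrite !inE /=.
  move=> /andP[/andP[vc /existsP[b h]] /andP[_ /upperE[v' [b' [h' e]]]]].
  have [|ev eb] := mt_induced h h'; first by rewrite -e subsetUr.
  have [cv bv] : c \notin v /\ b \notin v.
    by move/mt_edge: h; rewrite inE => /andP[-> _]; case/andP: vc.
  have : c \in b |: v by rewrite eb ev -e setU11.
  by rewrite !inE (negPf cv) orbF => /eqP ->.
have cU : #|untouched| + #|EA :|: EB| = m.*2.+1 * N.
  rewrite -card_all_edges -(cardsID (EA :|: EB) all_edges) addnC; congr (_ + _).
    apply: eq_card => p; rewrite in_setI in_setU ![_ \in EA]inE ![_ \in EB]inE.
    by case: (p \in all_edges); case: (lower _); case: (upper _).
  apply: eq_card => p; rewrite in_setD in_setU [_ \in EA]inE [_ \in EB]inE [LHS]inE.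
  by case: (p \in all_edges); case: (lower _); case: (upper _).
have := cardsUI EA EB; move: cU cI cA cB; rewrite -addnn; nia.
Qed.

(* (b, (v, (a, c))) encodes the hexagon on v :\ a and the elements a, b, c; its edge
   (v, b |: v) is matched but the opposite one is not. *)
Definition bad := [set q : T * ({set T} * (T * T)) |
  (q.2 \in swaps m q.1) && (mt q.2.1 q.1 && ~~ mt (swap q.2.1 q.2.2.1 q.2.2.2) q.1)].

(** The vertices [c |: v] and [b |: v :\ a] are adjacent to ends of the matching edge, hence
    unmatched. Were both hexagon edges leaving them towards the opposite edge touched, that edge
    would have both ends matched, so it would itself be a matching edge, contrary to badness. *)
Lemma bad_untouched b v a c : (b, (v, (a, c))) \in bad ->
  (swap v a c, a) \in untouched \/ (b |: v :\ a, c) \in untouched.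
Proof.
rewrite [_ \in bad]inE [_ \in swaps _ _]inE [_ \in slice _ _]inE in_setU1 /=.
move=> /andP[/and3P[/andP[bv /eqP cv] av]]; rewrite negb_or => /andP[cb cnv] /andP[h nh].
have ba : b != a by apply: contraNneq bv => ->.
have ca : c != a by apply: contraNneq cnv => ->.
have p1 : ~~ upper (a |: swap v a c).
  have -> : a |: swap v a c = c |: v by rewrite /swap setUCA setD1K.
  apply/upperE => -[v' [b' [h' e]]].
  have [|ev eb] := mt_induced h h'; first by rewrite -e subsetUr.
  have : c \in b' |: v' by rewrite -e setU11.
  by rewrite -ev -eb !inE (negPf cb) (negPf cnv).
have p4 : ~~ lower (b |: v :\ a).
  apply/existsP => -[e he].
  have [|ev _] := mt_induced he h; first by rewrite setUS // subsetDl.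
  by move: bv; rewrite -ev setU11.
have c2 : #|swap v a c| = m by rewrite card_swap.
have c4 : #|b |: v :\ a| = m.
  by rewrite cardsU1 !inE (negPf bv) andbF -cv [RHS](cardsD1 a) av.
have [l2|l2] := boolP (lower (swap v a c)); last first.
  left; rewrite [_ \in untouched]inE [_ \in all_edges]inE [_ \in slice _ _]inE /= p1 l2
    c2 eqxx !andbT.
  by rewrite !inE eq_sym (negPf ca) eqxx.
have [u3|u3] := boolP (upper (c |: (b |: v :\ a))); last first.
  right; rewrite [_ \in untouched]inE [_ \in all_edges]inE [_ \in slice _ _]inE /= p4
    u3 c4 eqxx !andbT.
  by rewrite !inE (negPf cb) (negPf cnv) andbF.
case/existsP: l2 => e h2; case/upperE: u3 => q [f [h3 e3]].
have e3' : b |: swap v a c = f |: q by rewrite -e3 setUCA.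
have [|ev ef] := mt_induced h2 h3; first by rewrite -e3' subsetUr.
case/negP: nh; suff -> : b = e by [].
have : b \in e |: swap v a c by rewrite ev ef -e3' setU11.
rewrite !inE (negPf bv) andbF [b == c]eq_sym (negPf cb) !orbF.
by move/eqP.
Qed.

(** Given which of the two untouched edges occurs, one further element determines the hexagon: [c]
    from the lower end in the first case, [a] outside the upper end in the second. Either way there
    are [m] choices, and uniqueness of partners recovers the matching edge. *)
Lemma card_bad : #|bad| <= 2 * m * #|untouched|.
Proof.
pose BA := [set q in bad | (swap q.2.1 q.2.2.1 q.2.2.2, q.2.2.1) \in untouched].
pose BB := [set q in bad | (q.1 |: q.2.1 :\ q.2.2.1, q.2.2.2) \in untouched].
have le : #|bad| <= #|BA| + #|BB|.
  apply: leq_trans (leq_card_setU BA BB); apply/subset_leq_card/subsetP.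
  move=> [b [v [a c]]] h; rewrite in_setU [_ \in BA]inE [_ \in BB]inE h /=.
  by have [->|->] := bad_untouched h; rewrite ?orbT.
have cA : #|BA| <= m * #|untouched|.
  pose D := [set q : ({set T} * T) * T | (q.1 \in untouched) && (q.2 \in q.1.1)].
  have -> : m * #|untouched| = #|D|.
    rewrite (card_dep_pair (mem untouched) (fun p c => c \in p.1)) mulnC -sum_nat_const.
    apply: eq_bigr => -[v b] /=; rewrite !inE /= => /andP[/andP[_ /eqP <-] _].
    by apply: eq_card => c; rewrite inE.
  have fI : {in BA &, injective (fun q : T * ({set T} * (T * T)) =>
      ((swap q.2.1 q.2.2.1 q.2.2.2, q.2.2.1), q.2.2.2))}.
    move=> [b [v [a c]]] [b' [v' [a' c']]];
      rewrite ![_ \in BA]inE ![_ \in bad]inE ![_ \in swaps _ _]inE /=.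
    move=> /andP[/andP[/andP[_ /andP[av cv]] /andP[h _]] _].
    move=> /andP[/andP[/andP[_ /andP[av' cv']] /andP[h' _]] _] [es ea ec].
    subst a' c'.
    have ev : v = v'.
      move: cv cv'; rewrite !inE !negb_or => /andP[_ cv] /andP[_ cv'].
      rewrite -(setD1K av) -(setD1K av'); congr (_ |: _).
      have unswap (w : {set T}) : c \notin w -> swap w a c :\ c = w :\ a.
        by move=> cw; rewrite setU1K // !inE negb_and cw orbT.
      by rewrite -(unswap v cv) -(unswap v' cv') es.
    subst v'.
    by have [_ ->] := mt_induced h h' (subsetUr _ _).
  rewrite -(card_in_imset fI);
    apply/subset_leq_card/subsetP => _ /imsetP[[b [v [a c]]] h ->].
  by move: h; rewrite [_ \in BA]inE [_ \in D]inE /= => /andP[_ ->]; rewrite setU11.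
have cB : #|BB| <= m * #|untouched|.
  pose D := [set q : ({set T} * T) * T | (q.1 \in untouched) && (q.2 \notin q.1.2 |:
    q.1.1)].
  have -> : m * #|untouched| = #|D|.
    rewrite (card_dep_pair (mem untouched) (fun p c
      => c \notin p.2 |: p.1)) mulnC -sum_nat_const.
    apply: eq_bigr => -[v b] /=; rewrite !inE /= => /andP[/andP[bv /eqP cv] _].
    have -> : [set c | c \notin b |: v] = ~: (b |: v) by apply/setP => c; rewrite !inE.
    by rewrite cardsCs setCK cardsU1 bv cv cardT -addnn; lia.
  have fI : {in BB &, injective (fun q : T * ({set T} * (T * T)) =>
      ((q.1 |: q.2.1 :\ q.2.2.1, q.2.2.2), q.2.2.1))}.
    move=> [b [v [a c]]] [b' [v' [a' c']]];
      rewrite ![_ \in BB]inE ![_ \in bad]inE ![_ \in swaps _ _]inE /=.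
    move=> /andP[/andP[/andP[_ /andP[av cv]] /andP[h _]] _].
    move=> /andP[/andP[/andP[_ /andP[av' cv']] /andP[h' _]] _] [es ec ea].
    subst a' c'.
    have e : b |: v = b' |: v'.
      by rewrite -(setD1K av) -(setD1K av') setUCA es setUCA.
    by have [-> ->] := mt_upper h h' e.
  rewrite -(card_in_imset fI);
    apply/subset_leq_card/subsetP => _ /imsetP[[b [v [a c]]] h ->].
  move: h; rewrite [_ \in BB]inE [_ \in D]inE /= => /andP[h ->] /=.
  move: h; rewrite [_ \in bad]inE [_ \in swaps _ _]inE [_ \in slice _ _]inE /=.
  move=> /andP[/andP[/andP[bv _] /andP[av cv]] _]; rewrite !inE eqxx /=.
  rewrite orbF negb_or; apply/andP; split.
    by apply: contraNneq cv => <-; rewrite inE av orbT.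
  by apply: contraNneq bv => <-.
by rewrite -mulnA mul2n -addnn; apply: leq_trans le (leq_add cA cB).
Qed.

Lemma card_bad_dir : #|bad| = \sum_b #|boundary m b [set v | mt v b]|.
Proof.
pose Q b q := (q \in swaps m b) && (mt q.1 b && ~~ mt (swap q.1 q.2.1 q.2.2) b).
transitivity #|[set q : T * ({set T} * (T * T)) | (q.1 \in T) && Q q.1 q.2]|.
  by apply: eq_card => q; rewrite !inE.
rewrite (card_dep_pair (mem T) Q); apply: eq_bigr => b _.
by apply: eq_card => q; rewrite [LHS]inE [RHS]inE ![_ \in [set v | mt v b]]inE.
Qed.

(** Summing the Poincare inequality over all directions bounds the sum of [f b * (N - f b)]. Taking
    [k] with [f k] maximal, each factor [N - f b] is at least [N - f k], and the remaining [f b] add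
    up to the size of the matching. *)
Lemma dominant_direction : 0 < m -> exists k,
  (N - #|[set v | mt v k]|) * #|matched| <= 2 * N * (m.*2.+1 * (N - #|matched|)).
Proof.
move=> m0; pose f b := #|[set v | mt v b]|.
have [b0 _] : exists b : T, b \in T by apply/card_gt0P; rewrite cardT.
exists [arg max_(k > b0) f k]; case: arg_maxnP => // k _ kmax.
have : \sum_b m * (f b * (N - f b)) <= N * (2 * m * #|untouched|).
  apply: leq_trans (leq_mul (leqnn N) card_bad).
  rewrite card_bad_dir big_distrr /=; apply: leq_sum => b _.
  by apply: slice_poincare => //; apply/subsetP => v; rewrite inE => /mt_edge.
have -> : N * (2 * m * #|untouched|) = m * (2 * N * #|untouched|) by ring.
rewrite -big_distrr leq_pmul2l //= => le.
have leU : #|untouched| <= m.*2.+1 * (N - #|matched|).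
  by have := card_untouched; rewrite mulnBr; lia.
apply: leq_trans (leq_trans le _).
  rewrite card_matched_dir mulnC big_distrl /=; apply: leq_sum => b _.
  by rewrite leq_mul2l leq_sub2l ?orbT //; apply: kmax.
by rewrite leq_mul2l leU orbT.
Qed.

End DirectedMatching.

(** * Translation from matchings of the middle layers graph to directed pairs *)

Lemma MI_induced (T : finType) (e : rel T) le I : induced_matching e (MI e le I).
Proof.
rewrite /MI; case: pickP => [M /andP[/andP[/and3P[]]] //|_] /=.
by apply/and3P; split; [exact: sub0set | |]; apply/forallP => E; rewrite inE.
Qed.

Section MiddleLayers.
Variable d : nat.
Hypothesis d1 : 1 < d.

Local Notation T := 'I_(2 * d - 1).

(** Selecting vertices by their values avoids size proofs, so the map is total; it yields a genuine
    edge when [v] is in the slice of [b], which is why [directed] demands this. *)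
Definition lift_edge (v : {set T}) (b : T) : {set Bvert d} :=
  [set x : Bvert d | (val x == v) || (val x == b |: v)].

Lemma card_ground : #|{: T}| = (d - 1).*2.+1.
Proof. by rewrite card_ord -addnn; lia. Qed.

Lemma lift_edgeP v b : v \in slice (d - 1) b -> exists x y : Bvert d,
  [/\ val x = v, val y = b |: v & lift_edge v b = [set x; y]].
Proof.
rewrite inE => /andP[bv /eqP cv].
have hx : (#|v| == d - 1) || (#|v| == d) by rewrite cv eqxx.
have cy : #|b |: v| = d by rewrite cardsU1 bv cv; lia.
have hy : (#|b |: v| == d - 1) || (#|b |: v| == d) by rewrite cy eqxx orbT.
exists (exist _ v hx : Bvert d), (exist _ (b |: v) hy : Bvert d); split => //.
by apply/setP => z; rewrite !inE -!val_eqE.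
Qed.

Variable M : {set {set Bvert d}}.

Definition directed (v : {set T}) : pred T :=
  fun b => (v \in slice (d - 1) b) && (lift_edge v b \in M).

Lemma directed_edge v b : directed v b -> v \in slice (d - 1) b.
Proof. by case/andP. Qed.

Hypothesis Mind : induced_matching (@Badj d) M.

(** Distinct edges would be joined by the edge from [v] to [b' |: v'], against inducedness. Once the
    edges coincide, the sizes [d - 1] and [d] tell their ends apart. *)
Lemma directed_induced v b v' b' :
  directed v b -> directed v' b' -> v \subset b' |: v' -> v = v' /\ b = b'.
Proof.
move=> /andP[sv Mv] /andP[sv' Mv'] sub.
have [x [y [xv yv e]]] := lift_edgeP sv; have [x' [y' [xv' yv' e']]] := lift_edgeP sv'.
move: sv sv'; rewrite !inE => /andP[bv /eqP cv] /andP[bv' /eqP cv'].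
have cy' : #|b' |: v'| = d by rewrite cardsU1 bv' cv'; lia.
have cy : #|b |: v| = d by rewrite cardsU1 bv cv; lia.
have Ee : lift_edge v b = lift_edge v' b'.
  apply/eqP/negPn/negP => ne; case/and3P: Mind => _ _ /forall_inP/(_ _ Mv).
  move=> /forall_inP/(_ _ Mv'); rewrite ne /= => /forall_inP/(_ x).
  rewrite e set21 => /(_ isT)/forall_inP/(_ y'); rewrite e' set22 => /(_ isT).
  rewrite /Badj xv yv' negb_or properEcard sub cv cy' /=.
  by have -> : d - 1 < d by lia.
have vv' : v = v'.
  have : x \in lift_edge v' b' by rewrite -Ee e set21.
  rewrite inE xv => /orP[/eqP//|/eqP vE].
  by move: cv; rewrite vE cy'; lia.
split=> //; have : y \in lift_edge v' b' by rewrite -Ee e set22.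
rewrite inE yv => /orP[/eqP vE|/eqP vE].
  by move: cv'; rewrite -vE cy; lia.
have : b \in b' |: v' by rewrite -vE setU11.
by rewrite -vv' !inE (negPf bv) orbF => /eqP.
Qed.

Lemma card_matching_directed : #|M| <= #|matched directed|.
Proof.
apply: leq_trans (leq_imset_card (fun p => lift_edge p.1 p.2) _).
apply/subset_leq_card/subsetP => E EM.
have [x [y [xy Exy]]] : exists x y : Bvert d, val x \proper val y /\ E = [set x; y].
  case/and3P: Mind => /subsetP/(_ _ EM) + _ _; rewrite inE.
  move=> /existsP[x /existsP[y /andP[/orP[xy|xy] /eqP ->]]]; first by exists x, y.
  by exists y, x; rewrite setUC.
have /andP[/eqP cx /eqP cy] : (#|val x| == d - 1) && (#|val y| == d).
  have := proper_card xy; have := valP x; have := valP y => /=.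
  by move=> /orP[]/eqP -> /orP[]/eqP ->; rewrite ?ltnn ?eqxx //; lia.
have [sub _] := properP xy.
have /eqP/cards1P[b yx] : #|val y :\: val x| = 1.
  by rewrite cardsDS // cx cy; lia.
have yE : val y = b |: val x by rewrite -yx setUC setDE setUIr setUCr setIT;
  apply/esym/setUidPr.
have bx : b \notin val x.
  by have : b \in val y :\: val x; [rewrite yx set11 | rewrite inE => /andP[]].
have EE : E = lift_edge (val x) b.
  by rewrite Exy; apply/setP => z; rewrite !inE -yE !val_eqE.
apply/imsetP; exists (val x, b) => //; rewrite inE /= /directed -EE EM.
by rewrite inE bx cx eqxx.
Qed.

Lemma card_directed k : #|[set v | directed v k]| <= #|M :&: Mdir k|.
Proof.
have fI : {in [set v | directed v k] &, injective (lift_edge^~ k)}.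
  move=> v v'; rewrite !inE => vd v'd e.
  have [x [y [xv yv E]]] := lift_edgeP (directed_edge vd).
  have : x \in lift_edge v' k by rewrite -e E set21.
  rewrite inE xv => /orP[/eqP//|/eqP vE].
  by move: (directed_edge vd); rewrite inE vE setU11.
rewrite -(card_in_imset fI); apply/subset_leq_card/subsetP => _ /imsetP[v + ->].
rewrite inE => vd; rewrite inE; case/andP: (vd) => sv -> /=.
have [x [y [xv yv ->]]] := lift_edgeP sv.
move: sv; rewrite !inE => /andP[kv /eqP cv].
apply/existsP; exists y; apply/existsP; exists x.
by rewrite xv yv setU11 cardsU1 kv cv setU1K // setUC !eqxx andbT /=; lia.
Qed.

End MiddleLayers.

(** * Real estimates and the conclusion *)

Import Order.TTheory GRing.Theory Num.Theory.
Local Open Scope ring_scope.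

Lemma powR_three_halves (R : realType) (x : R) : 0 <= x ->
  x `^ (3 / 2) = x * Num.sqrt x.
Proof.
move=> x0; have -> : 3 / 2 = 1 + 2^-1 :> R by lra.
rewrite powRD ?powRr1 ?powR12_sqrt //.
by rewrite gt_eqF // addr_gt0 // invr_gt0.
Qed.

(** The threshold 17/25 leaves more than 8/25 of the maximum for the matching, just what the
    constant 25 of the theorem requires. *)
Lemma log2_pow5_bound (R : realType) : exists d0 : nat, forall d : nat, (d0 <= d)%N ->
  2 * log2 (d%:R : R) ^+ 5 / (d%:R : R) `^ (3 / 2) <= 17 / 25.
Proof.
pose c : R := ln 2.
have c0 : 0 < c by rewrite ln_gt0 // ltr1n.
pose B : R := 25 / 17 * 240 / c ^+ 5.
have B0 : 0 <= B by rewrite divr_ge0 ?exprn_ge0 ?ltW //; lra.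
exists (maxn 1 (Num.bound (B ^+ 2))) => d; rewrite geq_max => /andP[d1 dB].
have d0 : 0 < d%:R :> R by rewrite ltr0n.
have s0 : 0 < Num.sqrt (d%:R : R) by rewrite sqrtr_gt0.
have sB : B <= Num.sqrt (d%:R : R).
  rewrite -[B]ger0_norm // -sqrtr_sqr ler_wsqrtr //.
  apply/ltW/(lt_le_trans (archi_boundP _)); first exact: sqr_ge0.
  by rewrite ler_nat.
have ln0 : 0 <= ln (d%:R : R) by rewrite ln_ge0 // ler1n.
have lnB : ln (d%:R : R) ^+ 5 <= 120 * d%:R.
  (* The degree-5 term of the exponential series gives [x ^+ 5 / 120 <= expR x], used at
     [x = ln d]. *)
  have := expR_ge1Dxn 4 ln0; rewrite lnK ?posrE // => h.
  have : ln (d%:R : R) ^+ 5 / 120 <= d%:R.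
    by apply: le_trans h; rewrite -[leLHS]add0r lerD.
  by rewrite ler_pdivrMr // mulrC.
rewrite powR_three_halves // /log2 -/c expr_div_n ler_pdivrMr ?mulr_gt0 //.
have cc : 0 < c ^+ 5 by rewrite exprn_gt0.
rewrite mulrA ler_pdivrMr //.
have h : 240 * (25 / 17) <= Num.sqrt d%:R * c ^+ 5.
  by rewrite -ler_pdivrMr // (le_trans _ sB) // /B; lra.
have h2 : 240 * (25 / 17) * d%:R <= Num.sqrt d%:R * c ^+ 5 * d%:R by rewrite ler_pM2r.
lra.
Qed.

Theorem theorem2p8 (R : realType) :
  exists d0 : nat, forall d : nat, (d0 <= d)%N ->
  forall le : rel {set {set Bvert d}}, total_order le ->
  forall I : {set Bvert d}, I \in J2 R le ->
  exists k : 'I_(2 * d - 1),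
    (1 - 25 * log2 (d%:R : R) ^+ 5 / Num.sqrt (d%:R : R))
      * ('C(2 * d - 2, d - 1))%:R
    <= #|MI (@Badj d) le I :&: Mdir k|%:R :> R.
Proof.
have [d0 d0P] := log2_pow5_bound R; exists (maxn 2 d0) => d.
rewrite geq_max => /andP[d1 /d0P {d0 d0P}].
move=> eps le _ I; rewrite inE => /andP[_ Mlarge].
set M := MI _ le I in Mlarge *.
have Mind : induced_matching (@Badj d) M by apply: MI_induced.
have m0 : (0 < d - 1)%N by lia.
have [k kP] := dominant_direction (card_ground d1) (@directed_edge d M)
  (directed_induced d1 Mind) m0.
exists k; apply: le_trans (_ : #|[set v | directed M v k]|%:R <= _); last first.
  by rewrite ler_nat card_directed.
have KN : (#|matched (directed M)| <= 'C(2 * d - 2, d - 1))%N.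
  have := card_untouched (card_ground d1) (@directed_edge d M) (directed_induced d1 Mind).
  have -> : (d - 1).*2 = (2 * d - 2)%N by rewrite -addnn; lia.
  by move/(leq_trans (leq_addl _ _)); rewrite leq_pmul2l.
have MK : (#|M| <= #|matched (directed M)|)%N by apply: card_matching_directed.
move: kP KN MK Mlarge eps.
have -> : (d - 1).*2 = (2 * d - 2)%N by rewrite -addnn; lia.
move: #|matched _| #|M| #|[set v | _]| => K m X.
have : (0 < 'C(2 * d - 2, d - 1))%N by rewrite bin_gt0; lia.
have -> : (2 * d - 2).+1 = (2 * d - 1)%N by lia.
move: 'C(_, _) => N N0 kP KN MK.
have dge0 : 0 <= d%:R :> R by apply: ler0n.
have L0 : 0 <= log2 (d%:R : R) ^+ 5.
  by rewrite exprn_ge0 // divr_ge0 // ln_ge0 // ler1n; lia.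
rewrite powR_three_halves //; move: (log2 _ ^+ 5) L0 => L L0.
have d0 : 0 < d%:R :> R by rewrite ltr0n; lia.
have s0 : 0 < Num.sqrt (d%:R : R) by rewrite sqrtr_gt0.
move: (Num.sqrt _) s0 => s s0 Mlarge eps.
set e := 2 * L / (d%:R * s) in Mlarge eps.
have e0 : 0 <= e by rewrite divr_ge0 ?mulr_ge0 // ltW.
(* The allowed loss of the theorem is rewritten through the deficit [e] of the matching. *)
have -> : 25 * L / s = 25 / 2 * d%:R * e by rewrite /e; field; lra.
move: e e0 Mlarge eps => e e0 Mlarge eps.
have n0 : 0 < N%:R :> R by rewrite ltr0n.
have KR : (1 - e) * N%:R < K%:R by apply: lt_le_trans Mlarge _; rewrite ler_nat.
have XR : (N%:R - X%:R) * K%:R <= 2 * N%:R * (2 * d%:R * (N%:R - K%:R)) :> R.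
  have h1 : (N%:R - X%:R) * K%:R <= ((N - X) * K)%:R :> R.
    (* Truncated subtraction can only exceed the real difference. *)
    by rewrite natrM ler_wpM2r // lerBlDr -natrD ler_nat; lia.
  apply: le_trans h1 _; rewrite -natrB // -!natrM ler_nat.
  apply: leq_trans kP _; rewrite leq_mul2l leq_mul2r; apply/orP; right.
  by apply/orP; right; lia.
rewrite leNgt; apply/negP => Xlt.
have h2 : N%:R - K%:R <= e * N%:R by lra.
have h3 : (25 / 2 * d%:R * e) * N%:R < N%:R - X%:R by lra.
have h4 : 8 / 25 * N%:R < K%:R :> R.
  by apply: le_lt_trans KR; rewrite ler_pM2r //; lra.
have h5 : (25 / 2 * d%:R * e) * N%:R * (8 / 25 * N%:R) < (N%:R - X%:R) * K%:R.
  by apply: ltr_pM => //; rewrite !mulr_ge0 ?invr_ge0 ?ler0n.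
have h6 : 2 * N%:R * (2 * d%:R * (N%:R - K%:R)) <= 2 * N%:R * (2 * d%:R * (e * N%:R)).
  by rewrite !ler_pM2l ?mulr_gt0.
have := lt_le_trans h5 (le_trans XR h6).
(* Since 25/2 times 8/25 is 4, the two bounds agree exactly, and the strict inequality is absurd. *)
suff -> : 25 / 2 * d%:R * e * N%:R * (8 / 25 * N%:R) =
  2 * N%:R * (2 * d%:R * (e * N%:R)) by rewrite ltxx.
by field.
Qed.
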